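(* Let $\mathbb V$ be an $N_K=N$ SUSY vertex algebra with odd translation operators $D^1,\dots,D^N$. Under the limit $\gamma\to0$ (i.e. under specialization of the formal variable $\gamma$ to $0$, where $\widetilde A_\gamma(\mathbb V)$ specializes to $\widetilde A_{\gamma=0}(\mathbb V)=R(\mathbb V)$), the odd linear operators $[a]\mapsto[D^ka]$ ($k=1,\dots,N$) on $\widetilde A_\gamma(\mathbb V)$ converge to the differentials on the $C_2$-Poisson algebra $R(\mathbb V)$ induced by $D^k$.
   Context: Everything is over $\mathbb C$ and in the super sense. Let $N\ge1$, $[N]=\{1,\dots,N\}$, $Z=(z,\zeta^1,\dots,\zeta^N)$ with $z$ an even and $\zeta^i$ odd indeterminates, $Z^{j|J}=z^j\zeta^{j_1}\cdots\zeta^{j_r}$ for $J=\{j_1<\dots<j_r\}\subset[N]$. For a superspace $\mathbb V$, $\mathbb V[[Z^{\pm1}]]=\mathbb V[[z^{\pm1}]][\zeta^1,\dots,\zeta^N]$, $\mathbb V((Z))=\mathbb V((z))[\zeta^1,\dots,\zeta^N]$. An $N_K=N$ SUSY vertex algebra (Heluani–Kac) is $(\mathbb V,Y,\mathbf 1,D^1,\dots,D^N)$: a superspace $\mathbb V$, an even linear map $a\mapsto Y(a,Z)=a(Z)=\sum_{j\in\mathbb Z,J\subset[N]}Z^{-1-j|[N]\setminus J}a_{(j|J)}\in(\mathrm{End}\,\mathbb V)[[Z^{\pm1}]]$, a nonzero even vector $\mathbf 1$, and odd operators $D^k$ on $\mathbb V$ (the odd translation operators), such that for all $a,b$: (i)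 $a(Z)b\in\mathbb V((Z))$; (ii) $Y(\mathbf 1,Z)=\mathrm{id}$, $a(Z)\mathbf 1=a+O(Z)$, $D^k\mathbf 1=0$; (iii) $[D^k,a(Z)]=(\partial_{\zeta^k}-\zeta^k\partial_z)a(Z)$; (iv) $(z-w)^M[a(Z),b(W)]=0$ for some $M\in\mathbb N$. Operations: for $a,b\in\mathbb V$, $n\ge1$, $a\bullet^\gamma_nb:=\mathrm{Res}_z\bigl[\frac{\gamma^ne^{\gamma z}}{(e^{\gamma z}-1)^n}a(z,0,\dots,0)b\bigr]dz\in\mathbb V[\gamma]$ for $\gamma$ a formal variable (kernel expanded in $\mathbb Q[\gamma]((z))$), and $a\bullet^{\gamma=0}_nb:=a_{(-n|[N])}b$. Zhu algebra: $\widetilde A_\gamma(\mathbb V)=\mathbb V[\gamma]/\mathrm{Span}_{\mathbb C[\gamma]}\{a\bullet^\gamma_nb\mid a,b\in\mathbb V,n\ge2\}$, a unital associative superalgebra with product $[a]\bullet^\gamma[b]=[a\bullet^\gamma_1b]$; the operators $D^k$ induce odd differentials $[a]\mapsto[D^ka]$ on it. $\widetilde A_{\gamma=0}(\mathbb V)$ is defined in the same way with $\bullet^{\gamma=0}_n$ and $\mathbb V$ in place of $\mathbb V[\gamma]$. $C_2$-Poisson algebra: $R(\mathbb V)=\mathbb V/C_2(\mathbb V)$, $C_2(\mathbb V)=\mathrm{Span}_{\mathbb C}\{a_{(j|J)}b\mid a,b\in\mathbb V,\ j\le-2,\ J\subset[N]\}$, with supercommutative product $[a]\cdot[b]=[a_{(-1|[N])}b]$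 and Poisson bracket $\{[a],[b]\}=[a_{(0|[N])}b]$; the operators $D^k$ induce odd differentials $[a]\mapsto[D^ka]$ on $R(\mathbb V)$. *)

(* Defs.v *)
From HB Require Import structures.
From mathcomp Require Import all_boot all_order all_algebra.
From mathcomp Require Import generic_quotient ring_quotient.
From mathcomp Require Import boolp classical_sets functions cardinality fsbigop.
From mathcomp Require Import reals.
From mathcomp Require Import complex.

Set Implicit Arguments.
Unset Strict Implicit.
Unset Printing Implicit Defensive.
Import Order.TTheory GRing.Theory Num.Theory.
Local Open Scope classical_set_scope.
Local Open Scope ring_scope.
Local Open Scope quotient_scope.

Section Span.
Variables (A : nzRingType) (M : lmodType A) (S : set M).

Definition lin_span : {pred M} := [pred x : M |
  `[< exists l : seq (A * M)%type,
        (forall p, p \in l -> S p.2) /\ x = \sum_(p <- l) p.1 *: p.2 >]].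

Lemma lin_spanP x : reflect
  (exists l : seq (A * M)%type,
     (forall p, p \in l -> S p.2) /\ x = \sum_(p <- l) p.1 *: p.2)
  (x \in lin_span).
Proof. exact: asboolP. Qed.

Lemma lin_span_closed : GRing.submod_closed lin_span.
Proof.
split=> [|c x y]; first by apply/lin_spanP; exists [::]; rewrite big_nil.
move=> /lin_spanP[l [Sl ->]] /lin_spanP[r [Sr ->]]; apply/lin_spanP.
exists ([seq (c * p.1, p.2) | p <- l] ++ r); split=> [p|].
  by rewrite mem_cat => /orP[/mapP[q ql ->]|/Sr//]; exact: Sl ql.
rewrite big_cat big_map /= scaler_sumr; congr (_ + _).
by apply: eq_bigr => p _; rewrite scalerA.
Qed.

HB.instance Definition _ :=
  GRing.isSubmodClosed.Build A M lin_span lin_span_closed.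

End Span.

Section QuotientModule.
Variables (A : nzRingType) (M : lmodType A) (S : set M).

(* M / Span_A(S) *)
Definition quot_span : Type := {ideal_quot lin_span S}.
HB.instance Definition _ := GRing.Zmodule.on quot_span.

Definition cls (x : M) : quot_span := \pi_{ideal_quot lin_span S} x.
Definition qrepr (x : quot_span) : M := repr (x : {ideal_quot lin_span S}).

Lemma qreprK : cancel qrepr cls.
Proof. exact: reprK. Qed.

Lemma clsP x y : reflect (cls x = cls y) (x - y \in lin_span S).
Proof. by rewrite Quotient.idealrBE; exact: eqP. Qed.

Lemma clsD : {morph cls : x y / x + y}.
Proof. by move=> x y; exact: (@pi_addr _ _ _ _ _ {ideal_quot lin_span S}). Qed.

Definition quot_scale (c : A) (x : quot_span) : quot_span := cls (c *: qrepr x).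

Lemma clsZ c x : cls (c *: x) = quot_scale c (cls x).
Proof.
by apply/clsP; rewrite -scalerBr rpredZ //; apply/clsP; rewrite qreprK.
Qed.

Fact quot_scalerA a b x :
  quot_scale a (quot_scale b x) = quot_scale (a * b) x.
Proof. by rewrite -[x]qreprK -!clsZ scalerA. Qed.
Fact quot_scale1r : left_id 1 quot_scale.
Proof. by move=> x; rewrite -[x]qreprK -clsZ scale1r. Qed.
Fact quot_scalerDr : right_distributive quot_scale +%R.
Proof.
by move=> a x y; rewrite -[x]qreprK -[y]qreprK -clsD -!clsZ -clsD scalerDr.
Qed.
Fact quot_scalerDl x : {morph quot_scale^~ x : a b / a + b}.
Proof. by move=> a b; rewrite -[x]qreprK -!clsZ -clsD scalerDl. Qed.

HB.instance Definition _ := GRing.Zmodule_isLmodule.Build A quot_span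
  quot_scalerA quot_scale1r quot_scalerDr quot_scalerDl.

Fact cls_is_linear : linear cls.
Proof. by move=> c x y; rewrite clsD clsZ. Qed.
HB.instance Definition _ :=
  GRing.isLinear.Build A M quot_span *:%R cls cls_is_linear.

End QuotientModule.

Section VPoly.
Variables (K : fieldType) (V : lmodType K).

(* V[gamma], a module over K[gamma] = {poly K} *)
Record vpoly : Type := VPoly {
  vcoef : nat -> V;
  vcoef_fin : exists n, forall i, (n <= i)%N -> vcoef i = 0 }.

Lemma vpolyP (f g : vpoly) : vcoef f =1 vcoef g -> f = g.
Proof.
case: f g => [f Hf] [g Hg] /= /funext fg; subst g.
by congr VPoly; exact: Prop_irrelevance.
Qed.

HB.instance Definition _ := gen_eqMixin vpoly.
HB.instance Definition _ := gen_choiceMixin vpoly.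

Program Definition vconst (v : V) : vpoly :=
  @VPoly (fun i => if i == 0%N then v else 0) _.
Next Obligation. by exists 1%N; case. Qed.

Program Definition vadd (f g : vpoly) : vpoly :=
  @VPoly (fun i => vcoef f i + vcoef g i) _.
Next Obligation.
have [[m Hm] [n Hn]] := (vcoef_fin f, vcoef_fin g).
by exists (maxn m n) => i; rewrite geq_max => /andP[/Hm -> /Hn ->]; rewrite addr0.
Qed.

Program Definition vopp (f : vpoly) : vpoly := @VPoly (fun i => - vcoef f i) _.
Next Obligation.
by have [n Hn] := vcoef_fin f; exists n => i /Hn ->; rewrite oppr0.
Qed.

Program Definition vscale (p : {poly K}) (f : vpoly) : vpoly :=
  @VPoly (fun i => \sum_(j < i.+1) p`_j *: vcoef f (i - j)) _.
Next Obligation.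
have [n Hn] := vcoef_fin f; exists (size p + n)%N => i le_i.
rewrite big1 // => j _; have [lt_j|le_j] := ltnP j (size p).
  rewrite Hn ?scaler0 // leq_subRL; last by rewrite -ltnS.
  by rewrite (leq_trans _ le_i) // leq_add2r ltnW.
by rewrite nth_default ?scale0r.
Qed.

Fact vaddA : associative vadd.
Proof. by move=> f g h; apply: vpolyP => i /=; rewrite addrA. Qed.
Fact vaddC : commutative vadd.
Proof. by move=> f g; apply: vpolyP => i /=; rewrite addrC. Qed.
Fact vadd0 : left_id (vconst 0) vadd.
Proof. by move=> f; apply: vpolyP => i /=; rewrite if_same add0r. Qed.
Fact vaddN : left_inverse (vconst 0) vopp vadd.
Proof. by move=> f; apply: vpolyP => i /=; rewrite if_same addNr. Qed.

HB.instance Definition _ := GRing.isZmodule.Build vpoly vaddA vaddC vadd0 vaddN.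

Fact vscaleDl f : {morph vscale^~ f : p q / p + q}.
Proof.
move=> p q; apply: vpolyP => i /=; rewrite -big_split.
by apply: eq_bigr => j _; rewrite coefD scalerDl.
Qed.

Fact vscaleDr p : {morph vscale p : f g / f + g}.
Proof.
move=> f g; apply: vpolyP => i /=; rewrite -big_split.
by apply: eq_bigr => j _; rewrite scalerDr.
Qed.

Lemma vcoef_scaleC c f i : vcoef (vscale c%:P f) i = c *: vcoef f i.
Proof.
rewrite /= big_ord_recl coefC subn0 big1 ?addr0 // => j _.
by rewrite coefC scale0r.
Qed.

Lemma vcoef_scaleMX p f i : vcoef (vscale (p * 'X) f) i =
  if i is k.+1 then vcoef (vscale p f) k else 0.
Proof.
rewrite /= big_ord_recl coefMX scale0r add0r.
case: i => [|k]; first by rewrite big_ord0.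
by apply: eq_bigr => j _; rewrite coefMX.
Qed.

Fact vscaleA p q f : vscale p (vscale q f) = vscale (p * q) f.
Proof.
elim/poly_ind: p => [|p c IHp].
  by rewrite mul0r; apply: vpolyP => i /=; rewrite !big1 // => j _;
    rewrite coef0 scale0r.
rewrite mulrDl !vscaleDl; congr (_ + _); apply: vpolyP => i.
  by rewrite -mulrA ['X * q]mulrC mulrA !vcoef_scaleMX IHp.
rewrite vcoef_scaleC mul_polyC /= scaler_sumr; apply: eq_bigr => j _.
by rewrite coefZ scalerA.
Qed.

Fact vscale1 : left_id 1 vscale.
Proof. by move=> f; apply: vpolyP => i; rewrite vcoef_scaleC scale1r. Qed.

HB.instance Definition _ := GRing.Zmodule_isLmodule.Build {poly K} vpoly
  vscaleA vscale1 vscaleDr vscaleDl.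

End VPoly.


(* [hom false] is the even part and [hom true] the odd part. *)
Record superspace (K : fieldType) : Type := Superspace {
  ss_sort :> lmodType K;
  hom : bool -> submodClosed ss_sort;
  hom_sum : forall v, exists u w, [/\ u \in hom false, w \in hom true & v = u + w];
  hom_direct : forall v, v \in hom false -> v \in hom true -> v = 0 }.

Section Series.
Variables (K : fieldType) (N : nat) (W : lmodType K).

(* W[[Z^{+-1}]]: [f I j] is the coefficient of z^j zeta^I, the variables being *)
(* written to the left of the coefficient and zeta^I in increasing order.      *)
Definition ser := {set 'I_N} -> int -> W.

(* zeta^k zeta^I = (-1)^(inv k I) zeta^(I u {k}) for k not in I. *)
Definition inv (k : 'I_N) (I : {set 'I_N}) : nat := #|[set i in I | (i < k)%N]%SET|.

Definition d_z (f : ser) : ser := fun I j => (j + 1)%:~R *: f I (j + 1).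

Definition d_zeta (k : 'I_N) (f : ser) : ser := fun I j =>
  if k \in I then 0 else (-1) ^+ inv k I *: f (k |: I) j.

Definition mul_zeta (k : 'I_N) (f : ser) : ser := fun I j =>
  if k \in I then (-1) ^+ inv k I *: f (I :\ k) j else 0.

(* An odd operator passes the odd variables: D (zeta^I v) = (-1)^|I| zeta^I Dv. *)
Definition odd_act (D : W -> W) (f : ser) : ser := fun I j =>
  (-1) ^+ #|I| *: D (f I j).

Definition laurent (f : ser) : Prop :=
  exists n : int, forall I j, j < n -> f I j = 0.

(* W[[Z^{+-1}, W^{+-1}]], W = (w, omega^1, ..., omega^N): [F I m J n] is the    *)
(* coefficient of z^m w^n zeta^I omega^J.                                       *)
Definition ser2 := {set 'I_N} -> int -> {set 'I_N} -> int -> W.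

Definition mul_zw (F : ser2) : ser2 := fun I m J n =>
  F I (m - 1) J n - F I m J (n - 1).

End Series.

(* [a(Z), b(W)] c for a, b of parities p, q. The signs come from moving a(Z)   *)
(* past omega^J, b(W) past zeta^I, and reordering to zeta^I omega^J:           *)
(*   a(Z) omega^J v = (-1)^(p|J|) omega^J a(Z) v,                              *)
(*   omega^J zeta^I = (-1)^(|I||J|) zeta^I omega^J.                            *)
Definition scomm2 (K : fieldType) (N : nat) (V : lmodType K)
    (Y : V -> V -> ser N V) (p q : bool) (a b c : V) : ser2 N V := fun I m J n =>
  (-1) ^+ (p * #|J| + #|I| * #|J|) *: Y a (Y b c J n) I m
  - (-1) ^+ (p * q) *: ((-1) ^+ (q * #|I|) *: Y b (Y a c I m) J n).

Record susyVA (K : fieldType) (N : nat) : Type := SusyVA {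
  sva_space :> superspace K;
  (* [Y a b] is a(Z)b *)
  Y : sva_space -> sva_space -> ser N sva_space;
  vac : sva_space;
  D : 'I_N -> {linear sva_space -> sva_space};
  Y_linearl : forall b I j, linear (fun a => Y a b I j);
  Y_linearr : forall a I j, linear (fun b => Y a b I j);
  Y_even : forall (p q : bool) a b I j, a \in hom sva_space p ->
    b \in hom sva_space q -> Y a b I j \in hom sva_space (p (+) q (+) odd #|I|);
  D_odd : forall k (p : bool) a, a \in hom sva_space p ->
    D k a \in hom sva_space (~~ p);
  vac_even : vac \in hom sva_space false;
  vac_neq0 : vac <> 0;
  Y_laurent : forall a b, laurent (Y a b);
  Y_vac : forall b I j,
    Y vac b I j = if (I == finset.set0) && (j == 0) then b else 0;
  Y_creation : forall a, (forall I j, j < 0 -> Y a vac I j = 0)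
    /\ Y a vac finset.set0 0 = a;
  D_vac : forall k, D k vac = 0;
  D_covariant : forall k (p : bool) a b I j, a \in hom sva_space p ->
    odd_act (D k) (Y a b) I j - (-1) ^+ p *: Y a (D k b) I j
    = d_zeta k (Y a b) I j - mul_zeta k (d_z (Y a b)) I j;
  Y_local : forall (p q : bool) a b,
    a \in hom sva_space p -> b \in hom sva_space q ->
    exists M : nat, forall c I m J n,
      iter M (@mul_zw K N sva_space) (scomm2 Y p q a b c) I m J n = 0 }.

(* a_(j|J), the coefficient of Z^{-1-j | [N] \ J} *)
Definition mode (K : fieldType) (N : nat) (V : susyVA K N) (a : V) (j : int)
    (J : {set 'I_N}) (b : V) : V := Y a b (~: J)%SET (- 1 - j).

Section PowerSeries.
Variable A : comNzRingType.

Definition ps := nat -> A.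
Definition ps_one : ps := fun i => (i == 0%N)%:R.
Definition ps_mul (f g : ps) : ps := fun i => \sum_(j < i.+1) f j * g (i - j)%N.
Definition ps_exp (f : ps) (n : nat) : ps := iter n (ps_mul f) ps_one.

(* The inverse of a power series with constant term 1. *)
Fixpoint ps_inv_seq (f : ps) (n : nat) : seq A :=
  if n is m.+1 then
    let s := ps_inv_seq f m in
    rcons s (- \sum_(j < m.+1) f (m.+1 - j)%N * s`_j)
  else [:: 1].
Definition ps_inv (f : ps) : ps := fun n => (ps_inv_seq f n)`_n.

Lemma size_ps_inv_seq f n : size (ps_inv_seq f n) = n.+1.
Proof. by elim: n => //= n IHn; rewrite size_rcons IHn. Qed.

Lemma nth_ps_inv_seq f n i : (i <= n)%N -> (ps_inv_seq f n)`_i = ps_inv f i.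
Proof.
elim: n => [|n IHn]; first by rewrite leqn0 => /eqP->.
rewrite leq_eqVlt => /predU1P[-> //|lt_in].
by rewrite /= nth_rcons size_ps_inv_seq lt_in IHn.
Qed.

Lemma ps_mulV f : f 0%N = 1 -> ps_mul f (ps_inv f) =1 ps_one.
Proof.
move=> f0 [|n]; first by rewrite /ps_mul big_ord1 f0 mul1r.
rewrite /ps_mul big_ord_recl f0 mul1r subn0 /= /ps_inv.
rewrite [X in X + _]/= nth_rcons size_ps_inv_seq ltnn eqxx.
rewrite (reindex_inj rev_ord_inj) /= addrC -sumrB big1 // => j _.
rewrite subKn // /bump leq0n add1n subSS (@nth_ps_inv_seq f n) ?leq_subr //.
by rewrite subrr.
Qed.

End PowerSeries.

Section Kernel.
Variable K : fieldType.

(* e^{gamma z} *)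
Definition exp_gz : ps {poly K} := fun i => (i`!%:R)^-1 *: 'X^i.

(* (e^{gamma z} - 1) / (gamma z) *)
Definition expm1_gz : ps {poly K} := fun i => (i.+1`!%:R)^-1 *: 'X^i.

(* The coefficient of z^m in the expansion in K[gamma]((z)) of the kernel      *)
(* gamma^n e^{gamma z} / (e^{gamma z} - 1)^n, which is z^{-n} times the power  *)
(* series e^{gamma z} ((e^{gamma z} - 1) / (gamma z))^{-n}.                    *)
Definition kern (n : nat) (m : int) : {poly K} :=
  if 0 <= m + n%:Z
  then ps_mul exp_gz (ps_exp (ps_inv expm1_gz) n) (absz (m + n%:Z))
  else 0.

End Kernel.

Section Zhu.
Variables (K : fieldType) (N : nat) (V : susyVA K N).

(* a .^gamma_n b, the residue in z of kern n (z) times                         *)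
(* a(z,0,...,0)b = \sum_m z^{-1-m} a_(m|[N]) b; the sum has finite support.     *)
Definition zhu_op (n : nat) (a b : V) : vpoly V :=
  \sum_(m \in [set: int]) kern K n m *: vconst (mode a m [set: 'I_N]%SET b).

(* a .^{gamma=0}_n b *)
Definition zhu0_op (n : nat) (a b : V) : V :=
  mode a (- n%:Z) [set: 'I_N]%SET b.

Definition zhu_rel : set (vpoly V) :=
  [set f | exists a b n, (2 <= n)%N /\ f = zhu_op n a b].
Definition zhu0_rel : set V :=
  [set v | exists a b n, (2 <= n)%N /\ v = zhu0_op n a b].
Definition C2_rel : set V :=
  [set v | exists a b j J, j <= -2 /\ v = mode a j J b].

Definition zhu : lmodType {poly K} := quot_span zhu_rel.
Definition C2alg : lmodType K := quot_span C2_rel.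

Definition zhu_cls (a : V) : zhu := cls zhu_rel (vconst a).
Definition C2_cls (a : V) : C2alg := cls C2_rel a.

Definition zhu_hom (p : bool) : set zhu :=
  [set x | exists f, (forall i, vcoef f i \in hom V p) /\ x = cls zhu_rel f].
Definition C2_hom (p : bool) : set C2alg :=
  [set x | exists a, a \in hom V p /\ x = C2_cls a].

(* The products of the Zhu algebra and of the C_2-Poisson algebra, and the     *)
(* bracket of the latter, are determined by these formulas, because the        *)
(* classes of elements of V generate both quotients.                           *)
Definition zhu_product (mul : zhu -> zhu -> zhu) : Prop :=
  [/\ forall y, linear (mul^~ y), forall x, linear (mul x)
    & forall a b, mul (zhu_cls a) (zhu_cls b) = cls zhu_rel (zhu_op 1 a b)].

Definition C2_product (mul : C2alg -> C2alg -> C2alg) : Prop :=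
  forall a b, mul (C2_cls a) (C2_cls b) = C2_cls (mode a (- 1) [set: 'I_N]%SET b).

Definition C2_bracket (br : C2alg -> C2alg -> C2alg) : Prop :=
  forall a b, br (C2_cls a) (C2_cls b) = C2_cls (mode a 0 [set: 'I_N]%SET b).

End Zhu.
Arguments zhu_rel {K N} V.
Arguments zhu0_rel {K N} V.
Arguments C2_rel {K N} V.
Arguments zhu_hom {K N} V p.
Arguments C2_hom {K N} V p.

Section Differential.
Variables (A : comNzRingType) (M : lmodType A) (hm : bool -> set M).

Definition odd_operator (d : M -> M) : Prop :=
  forall p x, hm p x -> hm (~~ p) (d x).

Definition odd_derivation (mul : M -> M -> M) (d : M -> M) : Prop :=
  forall (p : bool) x y, hm p x ->
    d (mul x y) = mul (d x) y + (-1) ^+ p *: mul x (d y).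

Definition square_zero (d : M -> M) : Prop := forall x, d (d x) = 0.

End Differential.

Definition zhu_odd_differential (K : fieldType) (N : nat) (V : susyVA K N)
    (d : zhu V -> zhu V) : Prop :=
  [/\ odd_operator (zhu_hom V) d, square_zero d
    & forall mul, zhu_product mul -> odd_derivation (zhu_hom V) mul d].

Definition C2_odd_differential (K : fieldType) (N : nat) (V : susyVA K N)
    (d : C2alg V -> C2alg V) : Prop :=
  [/\ odd_operator (C2_hom V) d, square_zero d,
      forall mul, C2_product mul -> odd_derivation (C2_hom V) mul d
    & forall br, C2_bracket br -> odd_derivation (C2_hom V) br d].

(* The specialization gamma = 0: a surjection Atilde_gamma(V) -> R(V), linear  *)
(* along K[gamma] -> K, gamma |-> 0, identifying R(V) with the quotient of     *)
(* Atilde_gamma(V) by gamma Atilde_gamma(V).                                   *)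
Definition zhu_specialization (K : fieldType) (N : nat) (V : susyVA K N)
    (sp : zhu V -> C2alg V) : Prop :=
  [/\ forall (p : {poly K}) x y, sp (p *: x + y) = p.[0] *: sp x + sp y,
      forall a, sp (zhu_cls a) = C2_cls a,
      forall x, sp x = 0 <-> exists y, x = 'X *: y
    & forall mulg mul0, zhu_product mulg -> C2_product mul0 ->
        forall x y, sp (mulg x y) = mul0 (sp x) (sp y)].

(* Main.v *)
(* The operator D^k differentiates every product a_(j|[N]) b up to sign: this is
   covariance at zeta = 0 combined with (D^k a)(Z) = (d/dzeta^k + zeta^k d/dz) a(Z).
   The latter follows from the axioms in two steps: both sides agree on the vacuum,
   where they solve the same differential equation D^l f = (d/dzeta^l - zeta^l d/dz) f,
   and fields local with all b(W) are determined by their action on the vacuum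
   (put w = 0 in (z - w)^M [X(Z), b(W)] 1 = 0). It also expresses every a_(j|J) b
   as +- (D^I a)_(j|[N]) b, I the complement of J, so that C_2(V) is spanned by
   the elements a_(-n|[N]) b, n >= 2.
   The kernel is z^-n times a series in gamma z with constant term 1, so a *_n b has constant term
   a_(-n|[N]) b, and D^k is a superderivation of each *_n. Finally
   (D^k)^2 a = a_(-2|[N]) 1 = a *_2 1 vanishes in both quotients. *)
From HB Require Import structures.
Require Import Defs.
From mathcomp Require Import all_boot all_order all_algebra.
From mathcomp Require Import boolp classical_sets fsbigop.
From mathcomp Require Import reals complex.
From mathcomp Require Import zify.

Set Implicit Arguments.
Unset Strict Implicit.
Unset Printing Implicit Defensive.
Import Order.TTheory GRing.Theory Num.Theory.
Local Open Scope ring_scope.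

Lemma linear_map0 (A : nzRingType) (M M' : lmodType A) (f : M -> M') :
  linear f -> f 0 = 0.
Proof. by move=> /(_ (-1) 0 0); rewrite scaler0 addr0 scaleN1r addNr. Qed.

(** * Signs from reordering the odd variables *)

Section Inversions.
Variable N : nat.

Lemma inv0 (k : 'I_N) : Defs.inv k finset.set0 = 0%N.
Proof. by apply/eqP; rewrite cards_eq0; apply/eqP/setP => i; rewrite !inE. Qed.

Lemma invU1 (k l : 'I_N) (I : {set 'I_N}) :
  l \notin I -> Defs.inv k (l |: I) = ((l < k) + Defs.inv k I)%N.
Proof.
move=> lI; rewrite /Defs.inv; have [lk|kl] := ltnP l k.
  rewrite -[[set i in l |: I | _]%SET](_ : l |: [set i in I | (i < k)%N] = _)%SET.
    by rewrite cardsU1 inE (negPf lI).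
  by apply/setP => i; rewrite !inE; case: eqP => // ->; rewrite lk.
apply: eq_card => i; rewrite !inE.
by case: eqP => // ->; rewrite ltnNge kl !andbF.
Qed.

End Inversions.

(** * Multiplication by powers of z - w *)

Section Locality.
Variables (K : fieldType) (N : nat) (W : lmodType K).
Implicit Types F G H : ser2 N W.

(** Multiplication by z - w leaves the odd exponents alone, so a relation between coefficients with
    different odd exponents [I] and [I'] survives it. [Y_D] compares [I] with [k |: I] in this
    way. *)
Lemma iter_mul_zw_lin (c : K) F G H I I' J :
    (forall m n, H I m J n = F I m J n - c *: G I' m J n) ->
  forall M m n, iter M (@mul_zw K N W) H I m J n =
    iter M (@mul_zw K N W) F I m J n - c *: iter M (@mul_zw K N W) G I' m J n.
Proof.
move=> HFG; elim=> [|M IHM] m n; first exact: HFG.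
rewrite !iterS {1}/mul_zw !IHM /mul_zw scalerBr !opprB.
by rewrite [X in _ + X]addrC addrACA [X in _ + X]addrC.
Qed.

Lemma iter_mul_zw_le F I J M L : (M <= L)%N ->
    (forall m n, iter M (@mul_zw K N W) F I m J n = 0) ->
  forall m n, iter L (@mul_zw K N W) F I m J n = 0.
Proof.
move=> /subnK <- F0; elim: (L - M)%N => //= r IHr m n.
by rewrite /mul_zw !IHr subrr.
Qed.

(** Without negative powers of w one may put w = 0; then (z - w)^M becomes z^M, which only shifts
    the exponent of z and can be cancelled. *)
Lemma mul_zw_regular F I J M : (forall m n, n < 0 -> F I m J n = 0) ->
    (forall m n, iter M (@mul_zw K N W) F I m J n = 0) ->
  forall m, F I m J 0 = 0.
Proof.
move=> Fneg F0 m.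
have [_ E] : (forall m n, n < 0 -> iter M (@mul_zw K N W) F I m J n = 0) /\
    (forall m, iter M (@mul_zw K N W) F I m J 0 = F I (m - M%:Z) J 0).
  elim: {F0} M => [|M [IH1 IH2]]; first by split=> // m'; rewrite subr0.
  split=> [m' n n0|m'] /=; rewrite /mul_zw.
    by rewrite !IH1 ?subrr //; lia.
  by rewrite IH2 IH1 ?subr0; [congr (F _ _ _ _); lia | lia].
by rewrite -[m](addrK M%:Z) -E F0.
Qed.

End Locality.

(** * Odd translation operators acting on fields *)

Section Translation.
Variables (K : fieldType) (N : nat) (V : susyVA K N).
Hypothesis char0 : [pchar K] =i pred0.
Implicit Types (a b c : V) (k l : 'I_N) (I J : {set 'I_N}) (j : int).


Lemma YDl a a' b I j : Y (a + a') b I j = Y a b I j + Y a' b I j.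
Proof. by have := Y_linearl b I j 1 a a'; rewrite !scale1r. Qed.

Lemma YDr a b b' I j : Y a (b + b') I j = Y a b I j + Y a b' I j.
Proof. by have := Y_linearr a I j 1 b b'; rewrite !scale1r. Qed.

Lemma Y0r a I j : Y a 0 I j = 0.
Proof. exact: (linear_map0 (Y_linearr a I j)). Qed.

Lemma Y0l b I j : Y 0 b I j = 0.
Proof. exact: (linear_map0 (Y_linearl b I j)). Qed.

Lemma YZr (x : K) a b I j : Y a (x *: b) I j = x *: Y a b I j.
Proof. by have := Y_linearr a I j x b 0; rewrite Y0r !addr0. Qed.

Lemma YZl (x : K) a b I j : Y (x *: a) b I j = x *: Y a b I j.
Proof. by have := Y_linearl b I j x a 0; rewrite Y0l !addr0. Qed.

Lemma superspace_ind (P : V -> Prop) :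
    (forall p a, a \in Defs.hom V p -> P a) ->
    (forall a b, P a -> P b -> P (a + b)) -> forall a, P a.
Proof.
move=> Ph PD a; have [u [w [/Ph Pu /Ph Pw ->]]] := Defs.hom_sum a.
exact: PD.
Qed.

(* On the vacuum [D_covariant] reads D^k f = (d/dzeta^k - zeta^k d/dz) f for *)
(* f = a(Z)1: here the coefficients of zeta^I with k not in I, and below the  *)
(* coefficient of zeta^k.                                                     *)
Lemma D_Y_vac_notin k (p : bool) a I j : a \in Defs.hom V p -> k \notin I ->
  Y a (vac V) (k |: I)%SET j =
  (-1) ^+ (#|I| + Defs.inv k I) *: D V k (Y a (vac V) I j).
Proof.
move=> ap kI; have := D_covariant k (vac V) I j ap.
rewrite /odd_act /d_zeta /mul_zeta (negPf kI) D_vac Y0r scaler0 !subr0 => /esym E.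
rewrite exprD mulrC -scalerA -E scalerA -exprD addnn -muln2 exprM.
by rewrite sqrr_sign scale1r.
Qed.

Lemma DD_Y_vac k (p : bool) a j : a \in Defs.hom V p ->
  (j + 1)%:~R *: Y a (vac V) finset.set0 (j + 1) =
  D V k (D V k (Y a (vac V) finset.set0 j)).
Proof.
move=> ap; have := D_covariant k (vac V) [set k]%SET j ap.
rewrite /odd_act /d_zeta /mul_zeta /d_z inE eqxx D_vac Y0r scaler0 subr0 sub0r.
rewrite cards1 scaleN1r => /oppr_inj.
rewrite -{2}[[set k]%SET]finset.setU0 invU1 ?inE // ltnn inv0 scale1r.
rewrite finset.setDv => <-.
rewrite -[X in Y a _ X j]finset.setU0 (D_Y_vac_notin _ ap) ?inE // cards0 inv0.
by rewrite scale1r.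
Qed.

Lemma DD_vac k (p : bool) a : a \in Defs.hom V p ->
  D V k (D V k a) = Y a (vac V) finset.set0 1.
Proof.
move=> ap; have := DD_Y_vac k 0 ap; rewrite add0r scale1r => ->.
by rewrite (Y_creation a).2.
Qed.

Lemma Y_D_vac k (p : bool) a I j : a \in Defs.hom V p -> k \notin I ->
  Y (D V k a) (vac V) I j = (-1) ^+ Defs.inv k I *: Y a (vac V) (k |: I)%SET j.
Proof.
move=> ap; have Dap := D_odd k ap.
move: {2}#|I| (erefl #|I|) => r; elim: r I => [|r IHr] I.
  move/eqP; rewrite cards_eq0 => /eqP -> k0; rewrite inv0 scale1r.
  rewrite (D_Y_vac_notin _ ap) // cards0 inv0 scale1r.
  case: j => [j|j]; last first.
    by rewrite !(Y_creation _).1 ?linear0 //; lia.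
  (* By [DD_Y_vac] both sides satisfy (j+1) f_(j+1) = D^k D^k f_j, so agreement at j = 0 propagates;
     dividing by j+1 needs characteristic 0. *)
  elim: j => [|j IHj]; first by rewrite !(Y_creation _).2.
  have nz : (j.+1%:Z)%:~R != 0 :> K.
    by have /pcharf0P -> := char0.
  apply: (scalerI nz); have -> : j.+1%:Z = j%:Z + 1 by lia.
  by rewrite (DD_Y_vac k _ Dap) IHj -linearZ_LR (DD_Y_vac k _ ap).
(* A variable zeta^l with l in [I] is peeled off, not zeta^k: both sides become D^l of a coefficient
   at [J], so D^k and D^l never have to be commuted. *)
move=> cI kI; have /card_gt0P [l lI] : (0 < #|I|)%N by rewrite cI.
have [/negPf lk] : l != k by apply: contraNneq kI => <-.
pose J := (I :\ l)%SET; have defI : I = (l |: J)%SET by rewrite finset.setD1K.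
have lJ : l \notin J by rewrite !inE eqxx.
have kJ : k \notin J by rewrite !inE negb_and kI orbT.
have cJ : #|J| = r by move: cI; rewrite defI cardsU1 lJ => -[].
have lkJ : l \notin (k |: J)%SET by rewrite !inE negb_or lk eqxx.
rewrite defI (D_Y_vac_notin _ Dap lJ) IHr //.
rewrite finset.setUCA (D_Y_vac_notin _ ap lkJ) linearZ_LR !scalerA -!exprD.
congr (_ *: _); rewrite cardsU1 kJ !invU1 // -[LHS]signr_odd -[RHS]signr_odd !oddD /=.
have : ((k < l) = ~~ (l < k))%N.
  by rewrite -leqNgt ltn_neqAle eq_sym -[_ == _ :> nat]/(l == k) lk.
by move=> ->; case: (l < k)%N; case: (odd #|J|); case: (odd (Defs.inv k J));
  case: (odd (Defs.inv l J)).
Qed.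

(** For k outside [I] the term zeta^k d/dz has no coefficient at zeta^I, so only d/dzeta^k appears.
    The identity known on the vacuum extends to every [b] by locality. *)
Lemma Y_D k a b I j : k \notin I ->
  Y (D V k a) b I j = (-1) ^+ Defs.inv k I *: Y a b (k |: I)%SET j.
Proof.
move=> kI; elim/superspace_ind: a => [p a ap|a a' Ha Ha']; last first.
  by rewrite linearD !YDl scalerDr Ha Ha'.
elim/superspace_ind: b => [q b bq|b b' Hb Hb']; last first.
  by rewrite !YDr scalerDr Hb Hb'.
have [M1 L1] := Y_local (D_odd k ap) bq; have [M2 L2] := Y_local ap bq.
pose s : K := (-1) ^+ Defs.inv k I.
pose H : ser2 N V := fun I' m J n => Y (D V k a) (Y b (vac V) J n) I' m
   - s *: Y a (Y b (vac V) J n) (k |: I')%SET m.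
(* The terms of the two supercommutators in which b(W) acts last cancel by [Y_D_vac]. Their signs
   match because passing from [a] to D^k a flips the parity, just as adding k to [I] does. *)
have HE m n : H I m finset.set0 n =
    scomm2 (@Y _ _ V) (~~ p) q (D V k a) b (vac V) I m finset.set0 n
    - s *: scomm2 (@Y _ _ V) p q a b (vac V) (k |: I)%SET m finset.set0 n.
  rewrite /H /scomm2 cards0 !muln0 !scale1r scalerBr.
  rewrite (Y_D_vac _ ap) // YZr cardsU1 kI !scalerA -!exprD.
  rewrite opprB [X in _ = _ + X]addrC [RHS]addrACA -[LHS]addr0; congr (_ + _).
  apply/esym/eqP; rewrite addrC subr_eq0; apply/eqP; congr (_ *: _).
  rewrite -[LHS]signr_odd -[RHS]signr_odd !oddD !oddM oddD !oddb.
  by case: p q {ap bq L1 L2} => [] []; do 2!case: (odd _).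
have H0 : forall m, H I m finset.set0 0 = 0.
  (* The exponent M1 + M2 kills both supercommutators, and b(W)1 has no negative powers of w, with
     value [b] at w^0. *)
  apply: (@mul_zw_regular _ _ _ _ _ _ (M1 + M2)) => [m n n0|m n].
    by rewrite /H (Y_creation b).1 // !Y0r scaler0 subrr.
  rewrite (iter_mul_zw_lin HE) (iter_mul_zw_le (M := M1)) ?leq_addr //.
  by rewrite (iter_mul_zw_le (M := M2)) ?leq_addl // scaler0 subrr.
by have := H0 j; rewrite /H (Y_creation b).2 => /eqP; rewrite subr_eq0 => /eqP ->.
Qed.


Lemma D_Y0 k (p : bool) a b j : a \in Defs.hom V p ->
  D V k (Y a b finset.set0 j) =
  Y (D V k a) b finset.set0 j + (-1) ^+ p *: Y a (D V k b) finset.set0 j.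
Proof.
move=> ap; have := D_covariant k b finset.set0 j ap.
rewrite /odd_act /d_zeta /mul_zeta inE cards0 scale1r subr0 => /eqP.
by rewrite subr_eq addrC => /eqP ->; rewrite Y_D ?inE // addrC.
Qed.

Lemma mode_setT a j b : mode a j [set: 'I_N]%SET b = Y a b finset.set0 (- 1 - j).
Proof. by rewrite /mode finset.setCT. Qed.

Lemma D_mode k (p : bool) a j b : a \in Defs.hom V p ->
  D V k (mode a j [set: 'I_N]%SET b) =
  mode (D V k a) j [set: 'I_N]%SET b
  + (-1) ^+ p *: mode a j [set: 'I_N]%SET (D V k b).
Proof. by rewrite !mode_setT; exact: D_Y0. Qed.

End Translation.

(** * Spans and maps induced on quotients *)

Section LinearSpan.
Variables (A : nzRingType).

Lemma mem_lin_span (M : lmodType A) (S : set M) s : S s -> s \in lin_span S.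
Proof.
move=> Ss; apply/lin_spanP; exists [:: (1, s)]; split=> [q|].
  by rewrite inE => /eqP ->.
by rewrite big_seq1 scale1r.
Qed.

Lemma lin_span_ind (M : lmodType A) (S : set M) (P : M -> Prop) :
    P 0 -> (forall c x y, S x -> P y -> P (c *: x + y)) ->
  forall x, x \in lin_span S -> P x.
Proof.
move=> P0 PS x /lin_spanP [l [Sl ->]]; elim: l Sl => [|q l IHl] Sl.
  by rewrite big_nil.
rewrite big_cons; apply: PS; first by apply: Sl; rewrite mem_head.
by apply: IHl => r rl; apply: Sl; rewrite inE rl orbT.
Qed.

Lemma lin_span_map (M M' : lmodType A) (S : set M) (S' : set M')
    (f : {linear M -> M'}) : (forall s, S s -> f s \in lin_span S') ->
  forall x, x \in lin_span S -> f x \in lin_span S'.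
Proof.
move=> fS; apply: lin_span_ind => [|c x y Sx fy]; first by rewrite linear0 rpred0.
by rewrite linearP rpredD // rpredZ // fS.
Qed.

Section Lift.
Variables (M M' : lmodType A) (S : set M) (S' : set M') (f : {linear M -> M'}).
Hypothesis fS : forall s, S s -> f s \in lin_span S'.

Definition quot_lift (x : quot_span S) : quot_span S' := cls S' (f (qrepr x)).

Lemma quot_liftE x : quot_lift (cls S x) = cls S' (f x).
Proof.
apply/clsP; rewrite -linearB; apply: (lin_span_map fS).
by apply/clsP; rewrite qreprK.
Qed.

Lemma quot_lift_is_linear : linear quot_lift.
Proof.
move=> c x y; rewrite -[x]qreprK -[y]qreprK -linearP !quot_liftE.
by rewrite !linearP.
Qed.

Lemma quot_lift_exists :
  exists g : {linear quot_span S -> quot_span S'},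
    forall x, g (cls S x) = cls S' (f x).
Proof.
pose g : {linear _ -> _} :=
  HB.pack quot_lift (GRing.isLinear.Build _ _ _ _ quot_lift quot_lift_is_linear).
by exists g; exact: quot_liftE.
Qed.

End Lift.
End LinearSpan.

(** * Polynomials in gamma with vector coefficients *)

Section VPolyTheory.
Variables (K : fieldType) (V : lmodType K).
Implicit Types (f g : vpoly V) (p : {poly K}) (v : V).

Lemma vcoefD f g i : vcoef (f + g) i = vcoef f i + vcoef g i.
Proof. by []. Qed.

Lemma vcoefB f g i : vcoef (f - g) i = vcoef f i - vcoef g i.
Proof. by []. Qed.

Lemma vcoef0 i : vcoef (0 : vpoly V) i = 0.
Proof. exact: if_same. Qed.

Lemma vcoef_sum (I : Type) (r : seq I) (F : I -> vpoly V) i :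
  vcoef (\sum_(j <- r) F j) i = \sum_(j <- r) vcoef (F j) i.
Proof.
exact: (big_morph (fun f => vcoef f i) (fun f g => vcoefD f g i) (vcoef0 i)).
Qed.

Lemma vcoef_scale_const p v i : vcoef (p *: vconst v) i = p`_i *: v.
Proof.
rewrite [LHS]/= big_ord_recr /= subnn eqxx big1 ?add0r // => j _.
by rewrite subn_eq0 leqNgt ltn_ord scaler0.
Qed.

Lemma vcoef_scale0 p f : vcoef (p *: f) 0 = p.[0] *: vcoef f 0.
Proof. by rewrite [LHS]/= big_ord1 horner_coef0. Qed.

Lemma vcoef_scale_sign (b : bool) f i :
  vcoef ((-1) ^+ b *: f) i = (-1) ^+ b *: vcoef f i.
Proof. by rewrite -(rmorph_sign polyC) -vcoef_scaleC. Qed.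

Lemma vcoef_scaleX f i : vcoef ('X *: f) i = if i is k.+1 then vcoef f k else 0.
Proof. by have := vcoef_scaleMX 1 f i; rewrite mul1r vscale1. Qed.

Lemma vconstD v w : vconst (v + w) = vconst v + vconst w.
Proof. by apply: vpolyP => -[|i] /=; rewrite ?addr0. Qed.

Lemma vpoly_divX f : vcoef f 0 = 0 -> exists g, f = 'X *: g.
Proof.
move=> f0; have gfin : exists n, forall i, (n <= i)%N -> vcoef f i.+1 = 0.
  by have [n Hn] := vcoef_fin f; exists n => i /leqW /Hn.
by exists (VPoly gfin); apply: vpolyP => -[|i]; rewrite vcoef_scaleX.
Qed.

(** The predicate [Q] carries a property of the coefficients, such as a fixed parity, through the
    induction over the monomials of [f]. *)
Lemma vpoly_ind (Q : V -> Prop) (P : vpoly V -> Prop) :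
    P 0 -> (forall p v f, Q v -> P f -> P (p *: vconst v + f)) ->
  forall f, (forall i, Q (vcoef f i)) -> P f.
Proof.
move=> P0 PS f Qf; have [n Hn] := vcoef_fin f.
have -> : f = \sum_(i <- iota 0 n) 'X^i *: vconst (vcoef f i).
  apply: vpolyP => j; rewrite vcoef_sum.
  rewrite (eq_bigr (fun i => if i == j then vcoef f i else 0)); last first.
    move=> i _; rewrite vcoef_scale_const coefXn eq_sym.
    by case: eqP; rewrite ?scale1r ?scale0r.
  have [jn|nj] := ltnP j n.
    rewrite (bigD1_seq j) ?iota_uniq ?mem_iota ?add0n //= eqxx big1 ?addr0 //.
    by move=> i /negPf ->.
  rewrite big_seq big1 ?Hn // => i; rewrite mem_iota add0n => lt_in.
  by case: eqP lt_in => // ->; rewrite ltnNge nj.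
by elim: (iota 0 n) => [|i r IHr]; rewrite ?big_nil // big_cons; exact: PS.
Qed.

Variable h : {linear V -> V}.

Lemma vmap_subproof f : exists n, forall i, (n <= i)%N -> h (vcoef f i) = 0.
Proof. by have [n Hn] := vcoef_fin f; exists n => i /Hn ->; rewrite linear0. Qed.

Definition vmap f : vpoly V := VPoly (vmap_subproof f).

Lemma vmap_is_linear : linear vmap.
Proof.
move=> p f g; apply: vpolyP => i /=; rewrite linearD linear_sum.
by congr (_ + _); apply: eq_bigr => j _; rewrite linearZ_LR.
Qed.

HB.instance Definition _ :=
  GRing.isLinear.Build {poly K} (vpoly V) (vpoly V) *:%R vmap vmap_is_linear.

Lemma vmap_const v : vmap (vconst v) = vconst (h v).
Proof. by apply: vpolyP => -[|i] /=; rewrite ?linear0. Qed.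

End VPolyTheory.

(** * Coefficients of the residue kernel *)

Section KernelTheory.
Variable K : fieldType.
Implicit Types f g : ps {poly K}.

(* f(gamma, z) depends only on the product gamma z. *)
Definition ps_diag f := forall i j, i != j -> (f i)`_j = 0.

Lemma ps_diag_mul f g : ps_diag f -> ps_diag g -> ps_diag (ps_mul f g).
Proof.
move=> df dg i j ij; rewrite /ps_mul coef_sum big1 // => k _.
rewrite coefM big1 // => l _; have [kl|kl] := eqVneq (k : nat) l.
  by rewrite dg ?mulr0 // kl; have := ltn_ord k; have := ltn_ord l; lia.
by rewrite df ?mul0r.
Qed.

Lemma ps_diag_exp f n : ps_diag f -> ps_diag (ps_exp f n).
Proof.
move=> df; elim: n => [|n IHn]; last exact: ps_diag_mul.
by move=> [|i] [|j] //= _; rewrite /ps_one ?coef1 ?coef0.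
Qed.

Lemma ps_invS f n :
  ps_inv f n.+1 = - \sum_(j < n.+1) f (n.+1 - j)%N * ps_inv f j.
Proof.
rewrite {1}/ps_inv /= nth_rcons size_ps_inv_seq ltnn eqxx; congr (- _).
by apply: eq_bigr => j _; rewrite nth_ps_inv_seq // -ltnS.
Qed.

Lemma ps_diag_inv f : ps_diag f -> ps_diag (ps_inv f).
Proof.
move=> df i; have [n] := ubnP i; elim: n i => // n IHn [|i] lt_in j ij.
  by rewrite /ps_inv /= coef1 eq_sym (negPf ij).
rewrite ps_invS coefN coef_sum big1 ?oppr0 // => k _.
rewrite coefM big1 // => l _; have := ltn_ord k; have := ltn_ord l => lj ki.
have [kl|kl] := eqVneq (i.+1 - k)%N l.
  by rewrite IHn ?mulr0 //; lia.
by rewrite df ?mul0r.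
Qed.

Lemma ps_diag_exp_gz : ps_diag (exp_gz K).
Proof. by move=> i j ij; rewrite coefZ coefXn eq_sym (negPf ij) mulr0. Qed.

Lemma ps_diag_expm1_gz : ps_diag (expm1_gz K).
Proof. by move=> i j ij; rewrite coefZ coefXn eq_sym (negPf ij) mulr0. Qed.

Lemma kernE n i : kern K n (i%:Z - n%:Z) =
  ps_mul (exp_gz K) (ps_exp (ps_inv (expm1_gz K)) n) i.
Proof. by rewrite /kern subrK. Qed.

(** Up to the factor z^-n the kernel is a series in gamma z, so z^(i-n) comes with gamma^i only. *)
Lemma kern_diag n i j : i != j -> (kern K n (i%:Z - n%:Z))`_j = 0.
Proof.
rewrite kernE; apply: ps_diag_mul; first exact: ps_diag_exp_gz.
by apply/ps_diag_exp/ps_diag_inv/ps_diag_expm1_gz.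
Qed.

Lemma kern_lead n : (kern K n (- n%:Z))`_0 = 1.
Proof.
have := kernE n 0; rewrite sub0r => ->; rewrite /ps_mul big_ord1 /exp_gz.
have -> : ps_exp (ps_inv (expm1_gz K)) n 0%N = 1.
  by elim: n => //= n IHn; rewrite /ps_mul big_ord1 IHn mulr1.
by rewrite mulr1 fact0 invr1 scale1r expr0 coef1.
Qed.

(** For n = 2 the kernel is the z-derivative of -gamma / (e^{gamma z} - 1), hence has no residue.
    The computation reduces to 1 - 1/2 - 1/2 = 0. *)
Lemma kern2_next : [pchar K] =i pred0 -> (kern K 2 (- 1))`_1 = 0.
Proof.
move=> char0; have -> : - 1 = 1%:Z - 2%:Z by [].
rewrite kernE.
rewrite /ps_exp /= /ps_mul !big_ord_recl !big_ord0 /=.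
rewrite /bump /= !addn0 subnn subn0.
rewrite !(mulr0, addr0, mulr1, mul1r).
rewrite /ps_inv /exp_gz /expm1_gz /= big_ord1 /=.
rewrite !subn0 !mulr1 fact0 invr1 !scale1r expr0 mul1r sub0r.
rewrite coefD coefB coefN !coefZ !coefX /= !mulr1 -opprD -mulr2n -(mulr_natr _^-1).
rewrite mulVf; first by rewrite addNr.
by have /pcharf0P -> := char0.
Qed.

End KernelTheory.

(** * The gamma-products and the spans they generate *)

Section ZhuAlgebra.
Variables (K : fieldType) (N : nat) (V : susyVA K N).
Hypothesis char0 : [pchar K] =i pred0.
Implicit Types (a b : V) (k : 'I_N).

(** By [kern_diag] a single mode contributes to each power of gamma. This turns statements on
    [zhu_op] into statements on one mode at a time. *)
Lemma vcoef_zhu_op n a b i :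
  vcoef (zhu_op n a b) i =
  (kern K n (i%:Z - n%:Z))`_i *: mode a (i%:Z - n%:Z) [set: 'I_N]%SET b.
Proof.
pose F m := kern K n m *: vconst (mode a m [set: 'I_N]%SET b).
have [n0 Yab] := Y_laurent a b.
(* The sum over all integers m = l - n is cut to 0 <= l < L: the kernel vanishes for l < 0 and the
   modes vanish for l >= L. The bound also exceeds [i], so that the surviving term is kept. *)
have [L [iL HL]] : exists L, (i < L)%N /\
    forall l, (L <= l)%N -> mode a (l%:Z - n%:Z) [set: 'I_N]%SET b = 0.
  exists (i.+1 + absz (n%:Z - 1 - n0)%R).+1; split; first by lia.
  by move=> l Ll; rewrite mode_setT Yab //; lia.
pose r := [seq l%:Z - n%:Z | l <- iota 0 L].
have ur : uniq r.
  by rewrite map_inj_uniq ?iota_uniq // => x y /addIr [].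
have -> : zhu_op n a b = \sum_(m <- r) F m.
  rewrite fsbig_seq // /zhu_op; apply/esym/fsbig_widen => // m [_ mr].
  rewrite /preimage /= /F; have [mn|mn] := leP 0 (m + n%:Z); last first.
    have -> : kern K n m = 0 by rewrite /kern; case: ifP => //; lia.
    by rewrite scale0r.
  have -> : m = (absz (m + n%:Z))%:Z - n%:Z by lia.
  rewrite HL.
    by apply: vpolyP => j; rewrite vcoef_scale_const scaler0 vcoef0.
  rewrite leqNgt; apply/negP => lt_L; case: mr => /=.
  by apply/mapP; exists (absz (m + n%:Z)); rewrite ?mem_iota //; lia.
rewrite vcoef_sum big_map (bigD1_seq i) ?iota_uniq ?mem_iota ?add0n //.
rewrite vcoef_scale_const (eq_bigr (fun=> 0)).
  by rewrite big1_eq; exact: addr0.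
by move=> l li; rewrite vcoef_scale_const kern_diag // scale0r.
Qed.

Lemma vcoef_zhu_op0 n a b : vcoef (zhu_op n a b) 0 = zhu0_op n a b.
Proof. by rewrite vcoef_zhu_op sub0r kern_lead scale1r. Qed.

Lemma zhu_opDl n a a' b : zhu_op n (a + a') b = zhu_op n a b + zhu_op n a' b.
Proof.
by apply: vpolyP => i; rewrite vcoefD !vcoef_zhu_op !mode_setT YDl scalerDr.
Qed.

Lemma vmap_D_zhu_op k (p : bool) n a b : a \in Defs.hom V p ->
  vmap (D V k) (zhu_op n a b) =
  zhu_op n (D V k a) b + (-1) ^+ p *: zhu_op n a (D V k b).
Proof.
move=> ap; apply: vpolyP => i.
rewrite vcoefD vcoef_scale_sign [LHS]/= !vcoef_zhu_op linearZ_LR /=.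
by rewrite (D_mode char0 k _ _ ap) scalerDr !scalerA mulrC.
Qed.

(** The mode -2 on the vacuum gives (D^k)^2 a, the mode -1 is removed by [kern2_next], and modes of
    index at least 0 annihilate the vacuum. *)
Lemma zhu_op2_vac (p : bool) k a : a \in Defs.hom V p ->
  zhu_op 2 a (vac V) = vconst (D V k (D V k a)).
Proof.
move=> ap; apply: vpolyP => i; rewrite vcoef_zhu_op mode_setT.
case: i => [|[|i]]; first by rewrite sub0r kern_lead scale1r (DD_vac k ap).
  by rewrite -[1%:Z - 2]/(- 1 : int) kern2_next // scale0r.
by rewrite (Y_creation a).1 ?scaler0 //; lia.
Qed.

Lemma Y_in_zhu0 a b (I : {set 'I_N}) j : 1 <= j ->
  Y a b I j \in lin_span (zhu0_rel V).
Proof.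
move=> j1; move: {2}#|I| (erefl #|I|) => r; elim: r I a => [|r IHr] I a.
  move/eqP; rewrite cards_eq0 => /eqP ->; apply: mem_lin_span.
  (* The coefficient of z^j is the mode of index -1-j, so n = j+1. *)
  exists a, b, (absz (j + 1)); split; first by lia.
  by rewrite /zhu0_op mode_setT; congr Y; lia.
move=> cI; have /card_gt0P [k kI] : (0 < #|I|)%N by rewrite cI.
have kI' : k \notin (I :\ k)%SET by rewrite !inE eqxx.
have := Y_D char0 a b j kI'; rewrite finset.setD1K // => E.
rewrite -[Y a b I j]scale1r -(sqrr_sign K (Defs.inv k (I :\ k))) expr2.
rewrite -scalerA -E.
rewrite rpredZ // IHr //.
by move: cI; rewrite (cardsD1 k) kI => -[].
Qed.

Lemma zhu0_C2 : lin_span (zhu0_rel V) =i lin_span (C2_rel V).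
Proof.
move=> x; apply/idP/idP.
  apply: (lin_span_map (f := idfun)) => s [a [b [n [n2 ->]]]].
  by apply: mem_lin_span; exists a, b, (- n%:Z), [set: 'I_N]%SET; split; [lia|].
apply: (lin_span_map (f := idfun)) => s [a [b [j [J [j2 ->]]]]].
by apply: Y_in_zhu0; lia.
Qed.

Lemma D_zhu0 k s : zhu0_rel V s -> D V k s \in lin_span (zhu0_rel V).
Proof.
move=> [a [b [n [n2 ->]]]]; rewrite /zhu0_op.
elim/superspace_ind: a => [p a ap|a a' Ha Ha'].
  rewrite (D_mode char0 k _ _ ap) rpredD // ?rpredZ //.
    by apply: mem_lin_span; exists (D V k a), b, n.
  by apply: mem_lin_span; exists a, (D V k b), n.
by move: Ha Ha'; rewrite !mode_setT YDl linearD; exact: rpredD.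
Qed.

(** [D_mode] treats only the modes with J = [N], so the smaller generating set from [zhu0_C2] is
    used. *)
Lemma D_C2 k s : C2_rel V s -> D V k s \in lin_span (C2_rel V).
Proof.
move=> /mem_lin_span; rewrite -!zhu0_C2.
by apply: lin_span_map; exact: D_zhu0.
Qed.

Lemma vmap_D_zhu k s : zhu_rel V s -> vmap (D V k) s \in lin_span (zhu_rel V).
Proof.
move=> [a [b [n [n2 ->]]]].
elim/superspace_ind: a => [p a ap|a a' Ha Ha'].
  rewrite (vmap_D_zhu_op k _ _ ap) rpredD // ?rpredZ //.
    by apply: mem_lin_span; exists (D V k a), b, n.
  by apply: mem_lin_span; exists a, (D V k b), n.
by rewrite zhu_opDl linearD rpredD.
Qed.

(** * Specialization at gamma = 0 *)

Definition zhu_sp (x : zhu V) : C2alg V := C2_cls (vcoef (qrepr x) 0).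

(** Independence of the representative: each defining relation has its constant term in C_2(V). *)
Lemma zhu_spE f : zhu_sp (cls (zhu_rel V) f) = C2_cls (vcoef f 0).
Proof.
apply/clsP; rewrite -vcoefB.
have : qrepr (cls (zhu_rel V) f) - f \in lin_span (zhu_rel V).
  by apply/clsP; rewrite qreprK.
move: (_ - _); apply: lin_span_ind => [|p x y]; first by rewrite vcoef0 rpred0.
move=> [a [b [n [n2 ->]]]] y0; rewrite vcoefD vcoef_scale0 vcoef_zhu_op0.
rewrite rpredD // rpredZ // -zhu0_C2 mem_lin_span //.
by exists a, b, n.
Qed.

Lemma zhu0_lift v : v \in lin_span (zhu0_rel V) ->
  exists2 f, f \in lin_span (zhu_rel V) & vcoef f 0 = v.
Proof.
move: v; apply: lin_span_ind => [|c x y [a [b [n [n2 ->]]]] [f Sf <-]].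
  by exists 0; rewrite ?rpred0 ?vcoef0.
exists (c%:P *: zhu_op n a b + f).
  by rewrite rpredD // rpredZ // mem_lin_span //; exists a, b, n.
by rewrite vcoefD vcoef_scale0 hornerC vcoef_zhu_op0.
Qed.

Lemma zhu_ind (Q : V -> Prop) (P : zhu V -> Prop) :
    P 0 -> (forall p v x, Q v -> P x -> P (p *: zhu_cls v + x)) ->
  forall f, (forall i, Q (vcoef f i)) -> P (cls (zhu_rel V) f).
Proof.
move=> P0 PS; apply: vpoly_ind => [|p v f Qv Pf]; first by rewrite linear0.
by rewrite linearP; exact: PS.
Qed.

Lemma zhu_gen (P : zhu V -> Prop) :
    P 0 -> (forall p v x, P x -> P (p *: zhu_cls v + x)) -> forall x, P x.
Proof.
move=> P0 PS x; rewrite -[x]qreprK; apply: (zhu_ind (Q := fun=> True)) => //.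
by move=> p v y _; exact: PS.
Qed.

Lemma zhu_sp_semilinear (p : {poly K}) x y :
  zhu_sp (p *: x + y) = p.[0] *: zhu_sp x + zhu_sp y.
Proof.
rewrite -[x]qreprK -[y]qreprK -linearP !zhu_spE vcoefD vcoef_scale0.
exact: linearP.
Qed.

Lemma zhu_sp_cls a : zhu_sp (zhu_cls a) = C2_cls a.
Proof. exact: zhu_spE. Qed.

Lemma zhu_sp0 : zhu_sp 0 = 0.
Proof.
by rewrite -(linear0 (cls (zhu_rel V))) zhu_spE vcoef0; exact: linear0.
Qed.

(** If the constant term of a representative lies in C_2(V), [zhu0_lift] gives a relation with the
    same constant term; subtracting it leaves a multiple of gamma. *)
Lemma zhu_sp_ker x : zhu_sp x = 0 <-> exists y, x = 'X *: y.
Proof.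
split=> [|[y ->]]; last first.
  by rewrite -['X *: y]addr0 zhu_sp_semilinear hornerX scale0r zhu_sp0 addr0.
rewrite -[x]qreprK zhu_spE -[RHS](linear0 (cls (C2_rel V))) => /clsP.
rewrite subr0 -zhu0_C2 => /zhu0_lift [f Sf f0].
have [g gE] : exists g, qrepr x - f = 'X *: g.
  by apply: vpoly_divX; rewrite vcoefB f0 subrr.
exists (cls (zhu_rel V) g); rewrite -linearZ_LR -gE; apply/clsP.
by rewrite opprB addrC subrK.
Qed.

(** Every element of [C2alg] is the class of a vector, so the formula fixes [mul] everywhere and
    bilinearity is inherited from [Y]. *)
Lemma C2_product_linear mul : @C2_product _ _ V mul ->
  (forall y, linear (mul^~ y)) /\ forall x, linear (mul x).
Proof.
move=> mulE; split=> [y c x x'|x c y y'].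
  rewrite -[x]qreprK -[x']qreprK -[y]qreprK -linearP !mulE -linearP.
  by rewrite !mode_setT YDl YZl.
rewrite -[x]qreprK -[y]qreprK -[y']qreprK -linearP !mulE -linearP.
by rewrite !mode_setT YDr YZr.
Qed.

Lemma zhu_sp_mul mulg mul0 : @zhu_product _ _ V mulg -> @C2_product _ _ V mul0 ->
  forall x y, zhu_sp (mulg x y) = mul0 (zhu_sp x) (zhu_sp y).
Proof.
move=> [mull mulr mulE] mul0E x y; have [mul0l mul0r] := C2_product_linear mul0E.
elim/zhu_gen: x => [|p v x IHx].
  by rewrite zhu_sp0 (linear_map0 (mull y)) (linear_map0 (mul0l _)) zhu_sp0.
rewrite mull !zhu_sp_semilinear mul0l IHx; congr (_ *: _ + _).
elim/zhu_gen: y {IHx} => [|q w y IHy].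
  by rewrite zhu_sp0 (linear_map0 (mulr _)) (linear_map0 (mul0r _)) zhu_sp0.
rewrite mulr !zhu_sp_semilinear mul0r IHy; congr (_ *: _ + _).
by rewrite mulE zhu_spE vcoef_zhu_op0 !zhu_sp_cls mul0E.
Qed.

Lemma zhu_sp_specialization : zhu_specialization zhu_sp.
Proof.
split; [exact: zhu_sp_semilinear|exact: zhu_sp_cls|exact: zhu_sp_ker|].
exact: zhu_sp_mul.
Qed.

(** * The induced differentials and their convergence *)

Section Differential.
Variables (k : 'I_N).

Lemma zhu_D_differential (d : {linear zhu V -> zhu V}) :
    (forall f, d (cls (zhu_rel V) f) = cls (zhu_rel V) (vmap (D V k) f)) ->
  zhu_odd_differential d.
Proof.
move=> dE.
have dv v : d (zhu_cls v) = zhu_cls (D V k v) by rewrite dE vmap_const.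
split=> [p _ [f [fp ->]]|x|mul [mull mulr mulE] p _ y [f [fp ->]]].
- by exists (vmap (D V k) f); split=> // i; exact: D_odd.
- elim/zhu_gen: x => [|q v x IHx]; first by rewrite !linear0.
  rewrite !linearP IHx addr0 !dv -[RHS](scaler0 _ q); congr (_ *: _).
  elim/superspace_ind: v => [p v vp|v w Hv Hw].
    (* The square of D^k on [v] is itself a defining relation, the product with n = 2 of [v] and the
       vacuum. *)
    rewrite /zhu_cls -(zhu_op2_vac k vp) -[RHS](linear0 (cls (zhu_rel V))).
    by apply/clsP; rewrite subr0 mem_lin_span //; exists v, (vac V), 2.
  by move: Hv Hw; rewrite /zhu_cls !linearD vconstD clsD => -> ->; rewrite addr0.
(* Only coefficients of parity [p] occur in [f], so the sign in the Leibniz rule is the same for all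
   its monomials. *)
apply: (zhu_ind (Q := fun v => v \in Defs.hom V p) (P := fun x =>
    d (mul x y) = mul (d x) y + (-1) ^+ p *: mul x (d y)) _ _ fp) => [|q v x vp IHx].
  by rewrite linear0 !(linear_map0 (mull _)) linear0 scaler0 addr0.
rewrite !linearP !mull linearP IHx [in RHS]scalerDr addrACA; congr (_ + _).
rewrite scalerA mulrC -scalerA -scalerDr; congr (_ *: _).
elim/zhu_gen: y {IHx} => [|r w y IHy].
  by rewrite linear0 !(linear_map0 (mulr _)) linear0 scaler0 addr0.
rewrite !linearP !mulr linearP IHy [in RHS]scalerDr [RHS]addrACA; congr (_ + _).
rewrite scalerA [_ * r]mulrC -scalerA -scalerDr; congr (_ *: _).
by rewrite !dv !mulE dE (vmap_D_zhu_op k _ _ vp) linearD linearZ_LR.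
Qed.

Lemma C2_D_differential (d : {linear C2alg V -> C2alg V}) :
  (forall a, d (C2_cls a) = C2_cls (D V k a)) -> C2_odd_differential d.
Proof.
move=> dE.
(* The product is the case j = -1 and the bracket the case j = 0. *)
have dM j (mul : C2alg V -> C2alg V -> C2alg V) :
    (forall a b, mul (C2_cls a) (C2_cls b) =
      C2_cls (mode a j [set: 'I_N]%SET b)) ->
    odd_derivation (C2_hom V) mul d.
  move=> mulE p _ y [a [ap ->]]; rewrite -[y]qreprK -/(C2_cls _) !dE !mulE dE.
  by rewrite (D_mode char0 k _ _ ap) /C2_cls linearD linearZ_LR.
split; [|move=> x|move=> mul mulE|move=> br brE].
- by move=> p _ [a [ap ->]]; exists (D V k a); split=> //; exact: D_odd.
- rewrite -[x]qreprK -/(C2_cls _) !dE; move: (qrepr x).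
  elim/superspace_ind => [p a ap|a b Ha Hb].
    rewrite (DD_vac k ap) -[RHS](linear0 (cls (C2_rel V))).
    apply/clsP; rewrite subr0 mem_lin_span //.
    exists a, (vac V), (- 2), [set: 'I_N]%SET.
    by rewrite mode_setT.
  by move: Ha Hb; rewrite /C2_cls 2!linearD clsD => -> ->; rewrite addr0.
- exact: dM mulE.
- exact: dM brE.
Qed.

Lemma zhu_D_converges :
  exists (Dg : {linear zhu V -> zhu V}) (D0 : {linear C2alg V -> C2alg V}),
    [/\ forall a, Dg (zhu_cls a) = zhu_cls (D V k a),
        forall a, D0 (C2_cls a) = C2_cls (D V k a),
        zhu_odd_differential Dg,
        C2_odd_differential D0
      & forall x, zhu_sp (Dg x) = D0 (zhu_sp x)].
Proof.
have [Dg DgE] := quot_lift_exists (@vmap_D_zhu k).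
have [D0 D0E] := quot_lift_exists (@D_C2 k).
exists Dg, D0; split=> [a||||x].
- by rewrite DgE /= vmap_const.
- exact: D0E.
- exact: (zhu_D_differential DgE).
- exact: (C2_D_differential D0E).
(* [vmap] acts coefficientwise, hence commutes with taking the constant term in gamma. *)
- by rewrite -[x]qreprK DgE !zhu_spE D0E.
Qed.

End Differential.
End ZhuAlgebra.

Theorem corollary3p11 (R : realType) (N : nat) (hN : (1 <= N)%N)
    (V : susyVA (complex R) N) :
  lin_span (zhu0_rel V) =i lin_span (C2_rel V) /\
  exists sp : zhu V -> C2alg V,
    zhu_specialization sp /\
    forall k : 'I_N,
      exists (Dg : {linear zhu V -> zhu V}) (D0 : {linear C2alg V -> C2alg V}),
        [/\ forall a, Dg (zhu_cls a) = zhu_cls (D V k a),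
            forall a, D0 (C2_cls a) = C2_cls (D V k a),
            zhu_odd_differential Dg,
            C2_odd_differential D0
          & forall x, sp (Dg x) = D0 (sp x)].
Proof.
have char0 : [pchar (complex R)] =i pred0 by exact: pchar_num.
split; first exact: zhu0_C2.
exists (@zhu_sp _ _ V); split; first exact: zhu_sp_specialization.
by move=> k; exact: zhu_D_converges.
Qed.
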